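(* Let $B$ be a locally centrally nilpotent skew brace. The following are equivalent: (1) $B$ is i-noetherian; (2) $B$ is finitely generated (as a skew brace) and it is centrally nilpotent; (3) $B$ is s-noetherian.
   Context: A skew brace is a set $B$ with two group operations $+$ and $\cdot$ (the latter written by juxtaposition; $+$ need not be commutative) such that $a(b+c)=ab-a+ac$ for all $a,b,c\in B$; both groups have the same identity, denoted $0$. For $a,b\in B$ put $\lambda_a(b)=-a+ab$. A subbrace of $B$ is a subset that is a subgroup of both $(B,+)$ and $(B,\cdot)$. An ideal is a subbrace $I$ with $(I,+)\unlhd(B,+)$, $(I,\cdot)\unlhd(B,\cdot)$ and $\lambda_a(I)\subseteq I$ for all $a\in B$; then $B/I$ is a skew brace. For $X\subseteq B$, the subbrace generated by $X$ is the intersection of all subbraces containing $X$; a subbrace is finitely generated if it is generated by a finite set. $B$ is i-noetherian (resp. s-noetherian) if it satisfies the maximal condition, i.e. the ascending chain condition, on ideals (resp. on subbraces). The centre is the ideal $\zeta(B)=\{a\in B\mid ab=ba=a+b=b+a\ \ \forall b\in B\}$; the central series is given by $\zeta_0(B)=0$ and $\zeta_{n+1}(B)/\zeta_n(B)=\zeta(B/\zeta_n(B))$. A skew brace $A$ is centrally nilpotent if $\zeta_n(A)=A$ for some natural number $n$. $B$ is locally centrally nilpotent if every finitely generated subbrace of $B$ is centrally nilpotent. *)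

(* Defs.v *)
From HB Require Import structures.
From mathcomp Require Import all_boot.
From mathcomp Require Import generic_quotient.
From mathcomp Require Import boolp classical_sets cardinality.

Set Implicit Arguments.
Unset Strict Implicit.
Unset Printing Implicit Defensive.

Declare Scope brace_scope.
Delimit Scope brace_scope with brace.

Local Open Scope classical_set_scope.
Local Open Scope quotient_scope.
Local Open Scope group_scope.
Local Open Scope brace_scope.

(* The library's additive groups are commutative, so the additive group of a
   skew brace is axiomatised here on top of the multiplicative groupType.
   That 0 = 1 is a consequence of the axioms (lemma sb1E). *)
HB.mixin Record isSkewBrace B of Group B := {
  sbzero : B;
  sbopp : B -> B;
  sbadd : B -> B -> B;
  sbaddA : associative sbadd;
  sbadd0r : left_id sbzero sbadd;
  sbaddNr : left_inverse sbzero sbopp sbadd;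
  sbmulDr : forall a b c : B,
    a * sbadd b c = sbadd (sbadd (a * b) (sbopp a)) (a * c)
}.

#[short(type="skewBraceType")]
HB.structure Definition SkewBrace := {B of Group B & isSkewBrace B}.

Notation "x + y" := (sbadd x y) : brace_scope.
Notation "- x" := (sbopp x) : brace_scope.
Notation "x - y" := (sbadd x (sbopp y)) : brace_scope.
Notation "0" := (@sbzero _) : brace_scope.

Definition lambda (B : skewBraceType) (a b : B) : B := - a + a * b.

Record is_subbrace (B : skewBraceType) (S : set B) : Prop := IsSubbrace {
  subbrace0 : S 0;
  subbraceD : forall x y, S x -> S y -> S (x + y);
  subbraceN : forall x, S x -> S (- x);
  subbrace1 : S 1;
  subbraceM : forall x y, S x -> S y -> S (x * y);
  subbraceV : forall x, S x -> S (x^-1)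
}.

Record is_ideal (B : skewBraceType) (I : set B) : Prop := IsIdeal {
  ideal_subbrace : is_subbrace I;
  ideal_normalD : forall x a, I x -> I (- a + x + a);
  ideal_normalM : forall x a, I x -> I (a^-1 * x * a);
  ideal_lambda : forall a x, I x -> I (lambda a x)
}.

Structure subbrace (B : skewBraceType) := Subbrace {
  subbrace_set :> set B;
  subbrace_setP : is_subbrace subbrace_set
}.

Structure ideal (B : skewBraceType) := Ideal {
  ideal_set :> set B;
  ideal_setP : is_ideal ideal_set
}.

Lemma sbaddrN (B : skewBraceType) (a : B) : a - a = 0.
Proof.
rewrite -[a - a]sbadd0r -[in LHS](sbaddNr (- a)) -sbaddA (sbaddA (- a)).
by rewrite sbaddNr sbadd0r sbaddNr.
Qed.

Lemma sbaddr0 (B : skewBraceType) (a : B) : a + 0 = a.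
Proof. by rewrite -(sbaddNr a) sbaddA sbaddrN sbadd0r. Qed.

Lemma sbaddKr (B : skewBraceType) (a b : B) : - a + (a + b) = b.
Proof. by rewrite sbaddA sbaddNr sbadd0r. Qed.

Lemma sbaddNKr (B : skewBraceType) (a b : B) : a + (- a + b) = b.
Proof. by rewrite sbaddA sbaddrN sbadd0r. Qed.

Lemma sbaddrI (B : skewBraceType) (a b c : B) : a + b = a + c -> b = c.
Proof. by move=> e; rewrite -(sbaddKr a b) e sbaddKr. Qed.

Lemma sbopp_uniq (B : skewBraceType) (a b : B) : a + b = 0 -> b = - a.
Proof. by move=> e; apply: (@sbaddrI _ a); rewrite e sbaddrN. Qed.

Lemma sboppK (B : skewBraceType) (a : B) : - - a = a.
Proof. by rewrite -(sbopp_uniq (sbaddNr a)). Qed.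

Lemma sbopp0 (B : skewBraceType) : - 0 = 0 :> B.
Proof. by rewrite -(sbopp_uniq (sbadd0r 0)). Qed.

Lemma sboppD (B : skewBraceType) (a b : B) : - (a + b) = - b - a.
Proof.
symmetry; apply: sbopp_uniq.
by rewrite -sbaddA sbaddNKr sbaddrN.
Qed.

Lemma sbmulr0 (B : skewBraceType) (a : B) : a * 0 = a.
Proof.
have := sbmulDr a 0 0; rewrite sbadd0r -sbaddA => e.
have {}e : - a + a * 0 = 0.
  by apply: (@sbaddrI _ (a * 0)); rewrite -e sbaddr0.
by rewrite -(sbaddNKr a (a * 0)) e sbaddr0.
Qed.

Lemma sb1E (B : skewBraceType) : 1 = 0 :> B.
Proof. by rewrite -(sbmulr0 1) mul1g. Qed.

Lemma mulE_lambda (B : skewBraceType) (a b : B) : a * b = a + lambda a b.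
Proof. by rewrite /lambda sbaddNKr. Qed.

Lemma lambdaD (B : skewBraceType) (a b c : B) :
  lambda a (b + c) = lambda a b + lambda a c.
Proof. by rewrite /lambda sbmulDr !sbaddA. Qed.

Lemma lambdar0 (B : skewBraceType) (a : B) : lambda a 0 = 0.
Proof. by rewrite /lambda sbmulr0 sbaddNr. Qed.

Lemma lambdaN (B : skewBraceType) (a b : B) : lambda a (- b) = - lambda a b.
Proof. by apply: sbopp_uniq; rewrite -lambdaD sbaddrN lambdar0. Qed.

Lemma lambdaM (B : skewBraceType) (a b c : B) :
  lambda (a * b) c = lambda a (lambda b c).
Proof.
apply: (@sbaddrI _ (a * b)); rewrite -mulE_lambda -mulgA.
by rewrite (mulE_lambda a (b * c)) (mulE_lambda b c) lambdaD sbaddA -mulE_lambda.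
Qed.

Lemma lambda1 (B : skewBraceType) (b : B) : lambda 1 b = b.
Proof. by rewrite /lambda mul1g sb1E sbopp0 sbadd0r. Qed.

Lemma lambdaVK (B : skewBraceType) (a b : B) : lambda a (lambda a^-1 b) = b.
Proof. by rewrite -lambdaM mulgV lambda1. Qed.

Definition subbrace_sort (B : skewBraceType) (S : subbrace B) : Type :=
  set_type S.

HB.instance Definition _ (B : skewBraceType) (S : subbrace B) :=
  Choice.on (subbrace_sort S).

Definition sub_elt (B : skewBraceType) (S : subbrace B) (x : B) (Sx : subbrace_set S x) :
  subbrace_sort S := exist _ x (mem_set Sx).

Lemma sub_eltP (B : skewBraceType) (S : subbrace B) (u : subbrace_sort S) :
  subbrace_set S (val u).
Proof. exact: set_mem (valP u). Qed.

Definition sub_one (B : skewBraceType) (S : subbrace B) : subbrace_sort S :=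
  sub_elt (subbrace1 (subbrace_setP S)).

Definition sub_mul (B : skewBraceType) (S : subbrace B)
    (u v : subbrace_sort S) : subbrace_sort S :=
  sub_elt (subbraceM (subbrace_setP S) (sub_eltP u) (sub_eltP v)).

Definition sub_inv (B : skewBraceType) (S : subbrace B)
    (u : subbrace_sort S) : subbrace_sort S :=
  sub_elt (subbraceV (subbrace_setP S) (sub_eltP u)).

Definition sub_zero (B : skewBraceType) (S : subbrace B) : subbrace_sort S :=
  sub_elt (subbrace0 (subbrace_setP S)).

Definition sub_add (B : skewBraceType) (S : subbrace B)
    (u v : subbrace_sort S) : subbrace_sort S :=
  sub_elt (subbraceD (subbrace_setP S) (sub_eltP u) (sub_eltP v)).

Definition sub_opp (B : skewBraceType) (S : subbrace B)
    (u : subbrace_sort S) : subbrace_sort S :=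
  sub_elt (subbraceN (subbrace_setP S) (sub_eltP u)).

Lemma sub_mulA (B : skewBraceType) (S : subbrace B) :
  associative (@sub_mul B S).
Proof. by move=> u v w; apply: val_inj; rewrite /= mulgA. Qed.

Lemma sub_mul1g (B : skewBraceType) (S : subbrace B) :
  left_id (sub_one S) (@sub_mul B S).
Proof. by move=> u; apply: val_inj; rewrite /= mul1g. Qed.

Lemma sub_mulg1 (B : skewBraceType) (S : subbrace B) :
  right_id (sub_one S) (@sub_mul B S).
Proof. by move=> u; apply: val_inj; rewrite /= mulg1. Qed.

Lemma sub_mulVg (B : skewBraceType) (S : subbrace B) :
  left_inverse (sub_one S) (@sub_inv B S) (@sub_mul B S).
Proof. by move=> u; apply: val_inj; rewrite /= mulVg. Qed.

Lemma sub_mulgV (B : skewBraceType) (S : subbrace B) :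
  right_inverse (sub_one S) (@sub_inv B S) (@sub_mul B S).
Proof. by move=> u; apply: val_inj; rewrite /= mulgV. Qed.

HB.instance Definition _ (B : skewBraceType) (S : subbrace B) :=
  isGroup.Build (subbrace_sort S) (@sub_mulA B S) (@sub_mul1g B S)
    (@sub_mulg1 B S) (@sub_mulVg B S) (@sub_mulgV B S).

Lemma sub_addA (B : skewBraceType) (S : subbrace B) :
  associative (@sub_add B S).
Proof. by move=> a b c; apply: val_inj; rewrite /= sbaddA. Qed.

Lemma sub_add0r (B : skewBraceType) (S : subbrace B) :
  left_id (sub_zero S) (@sub_add B S).
Proof. by move=> a; apply: val_inj; rewrite /= sbadd0r. Qed.

Lemma sub_addNr (B : skewBraceType) (S : subbrace B) :
  left_inverse (sub_zero S) (@sub_opp B S) (@sub_add B S).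
Proof. by move=> a; apply: val_inj; rewrite /= sbaddNr. Qed.

Lemma sub_mulDr (B : skewBraceType) (S : subbrace B) (a b c : subbrace_sort S) :
  a * sub_add b c = sub_add (sub_add (a * b) (sub_opp a)) (a * c).
Proof. by apply: val_inj; rewrite /= sbmulDr. Qed.

HB.instance Definition _ (B : skewBraceType) (S : subbrace B) :=
  isSkewBrace.Build (subbrace_sort S) (@sub_addA B S) (@sub_add0r B S)
    (@sub_addNr B S) (@sub_mulDr B S).

Coercion subbrace_brace (B : skewBraceType) (S : subbrace B) : skewBraceType :=
  subbrace_sort S.

(* a + I = b + I; equivalently a I = b I, by ideal_eqMP. *)
Definition ideal_eq (B : skewBraceType) (I : ideal B) (a b : B) : bool :=
  `[< ideal_set I (- a + b) >].

Lemma ideal_eqP (B : skewBraceType) (I : ideal B) (a b : B) :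
  reflect (exists2 i, ideal_set I i & b = a + i) (ideal_eq I a b).
Proof.
apply: (iffP (asboolP _)) => [Iab|[i Ii ->]]; last by rewrite sbaddKr.
by exists (- a + b); rewrite ?sbaddNKr.
Qed.

Lemma ideal_eq_refl (B : skewBraceType) (I : ideal B) : reflexive (ideal_eq I).
Proof.
move=> a; apply/asboolP; rewrite sbaddNr.
exact: subbrace0 (ideal_subbrace (ideal_setP I)).
Qed.

Lemma ideal_eq_sym (B : skewBraceType) (I : ideal B) : symmetric (ideal_eq I).
Proof.
have H a b : ideal_eq I a b -> ideal_eq I b a.
  move=> /asboolP Iab; apply/asboolP.
  have -> : - b + a = - (- a + b) by rewrite sboppD sboppK.
  exact (subbraceN (ideal_subbrace (ideal_setP I)) Iab).
by move=> a b; apply/idP/idP; apply: H.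
Qed.

Lemma ideal_eq_trans (B : skewBraceType) (I : ideal B) : transitive (ideal_eq I).
Proof.
move=> b a c /asboolP Iab /asboolP Ibc; apply/asboolP.
have -> : - a + c = (- a + b) + (- b + c) by rewrite -sbaddA sbaddNKr.
exact (subbraceD (ideal_subbrace (ideal_setP I)) Iab Ibc).
Qed.

Canonical ideal_eq_equiv (B : skewBraceType) (I : ideal B) :=
  EquivRel (ideal_eq I) (ideal_eq_refl I) (ideal_eq_sym I) (@ideal_eq_trans B I).

Lemma ideal_eqMP (B : skewBraceType) (I : ideal B) (a b : B) :
  reflect (exists2 i, ideal_set I i & b = a * i) (ideal_eq I a b).
Proof.
have Il := ideal_lambda (ideal_setP I).
apply: (iffP (ideal_eqP I a b)) => -[i Ii ->].
  exists (lambda a^-1 i); first exact: Il.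
  by rewrite mulE_lambda lambdaVK.
by exists (lambda a i); [exact: Il | rewrite mulE_lambda].
Qed.

Lemma ideal_eqD (B : skewBraceType) (I : ideal B) (a b c d : B) :
  ideal_eq I a b -> ideal_eq I c d -> ideal_eq I (a + c) (b + d).
Proof.
move=> /ideal_eqP[i Ii ->] /ideal_eqP[j Ij ->]; apply/ideal_eqP.
exists (- c + i + c + j); last first.
  by rewrite -!sbaddA sbaddNKr.
apply: (subbraceD (ideal_subbrace (ideal_setP I)) _ Ij).
exact (ideal_normalD (ideal_setP I) _ Ii).
Qed.

Lemma ideal_eqN (B : skewBraceType) (I : ideal B) (a b : B) :
  ideal_eq I a b -> ideal_eq I (- a) (- b).
Proof.
move=> /ideal_eqP[i Ii ->]; apply/asboolP; rewrite sboppK sboppD.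
have := ideal_normalD (ideal_setP I) (- a)
  (subbraceN (ideal_subbrace (ideal_setP I)) Ii).
by rewrite sboppK -sbaddA.
Qed.

Lemma ideal_eqM (B : skewBraceType) (I : ideal B) (a b c d : B) :
  ideal_eq I a b -> ideal_eq I c d -> ideal_eq I (a * c) (b * d).
Proof.
move=> /ideal_eqMP[i Ii ->] /ideal_eqMP[j Ij ->]; apply/ideal_eqMP.
exists (c^-1 * i * c * j); last by rewrite !mulgA mulgK.
apply: (subbraceM (ideal_subbrace (ideal_setP I)) _ Ij).
exact (ideal_normalM (ideal_setP I) _ Ii).
Qed.

Lemma ideal_eqV (B : skewBraceType) (I : ideal B) (a b : B) :
  ideal_eq I a b -> ideal_eq I (a^-1) (b^-1).
Proof.
move=> /ideal_eqMP[i Ii ->]; apply/ideal_eqMP.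
exists (a * i^-1 * a^-1); last by rewrite invgM !mulgA mulVg mul1g.
have := ideal_normalM (ideal_setP I) (a^-1)
  (subbraceV (ideal_subbrace (ideal_setP I)) Ii).
by rewrite invgK.
Qed.

Definition quot (B : skewBraceType) (I : ideal B) : Type :=
  {eq_quot (ideal_eq_equiv I)}.

HB.instance Definition _ (B : skewBraceType) (I : ideal B) :=
  Choice.on (quot I).

Definition quot_pi (B : skewBraceType) (I : ideal B) (a : B) : quot I :=
  \pi_({eq_quot (ideal_eq_equiv I)}) a.

Definition quot_repr (B : skewBraceType) (I : ideal B) (u : quot I) : B :=
  repr (u : {eq_quot (ideal_eq_equiv I)}).

Lemma quot_reprK (B : skewBraceType) (I : ideal B) (u : quot I) :
  quot_pi I (quot_repr u) = u.
Proof. exact: reprK. Qed.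

Lemma quot_piP (B : skewBraceType) (I : ideal B) (a b : B) :
  quot_pi I a = quot_pi I b <-> ideal_set I (- a + b).
Proof.
by split=> [/eqmodP/asboolP //|Iab]; apply/eqmodP/asboolP.
Qed.

Lemma quot_piW (B : skewBraceType) (I : ideal B) (P : quot I -> Prop) :
  (forall a, P (quot_pi I a)) -> forall u, P u.
Proof. by move=> Ppi u; rewrite -(quot_reprK u). Qed.

Lemma quot_reprP (B : skewBraceType) (I : ideal B) (a : B) :
  ideal_eq I (quot_repr (quot_pi I a)) a.
Proof. by apply/asboolP/quot_piP; rewrite quot_reprK. Qed.

Definition quot_one (B : skewBraceType) (I : ideal B) : quot I := quot_pi I 1.

Definition quot_mul (B : skewBraceType) (I : ideal B) (u v : quot I) : quot I :=
  quot_pi I (quot_repr u * quot_repr v).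

Definition quot_inv (B : skewBraceType) (I : ideal B) (u : quot I) : quot I :=
  quot_pi I (quot_repr u)^-1.

Definition quot_zero (B : skewBraceType) (I : ideal B) : quot I := quot_pi I 0.

Definition quot_add (B : skewBraceType) (I : ideal B) (u v : quot I) : quot I :=
  quot_pi I (quot_repr u + quot_repr v).

Definition quot_opp (B : skewBraceType) (I : ideal B) (u : quot I) : quot I :=
  quot_pi I (- quot_repr u).

Lemma quot_mulE (B : skewBraceType) (I : ideal B) (a b : B) :
  quot_mul (quot_pi I a) (quot_pi I b) = quot_pi I (a * b).
Proof. by apply/quot_piP/asboolP; apply: ideal_eqM; apply: quot_reprP. Qed.

Lemma quot_invE (B : skewBraceType) (I : ideal B) (a : B) :
  quot_inv (quot_pi I a) = quot_pi I a^-1.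
Proof. by apply/quot_piP/asboolP; apply: ideal_eqV; apply: quot_reprP. Qed.

Lemma quot_addE (B : skewBraceType) (I : ideal B) (a b : B) :
  quot_add (quot_pi I a) (quot_pi I b) = quot_pi I (a + b).
Proof. by apply/quot_piP/asboolP; apply: ideal_eqD; apply: quot_reprP. Qed.

Lemma quot_oppE (B : skewBraceType) (I : ideal B) (a : B) :
  quot_opp (quot_pi I a) = quot_pi I (- a).
Proof. by apply/quot_piP/asboolP; apply: ideal_eqN; apply: quot_reprP. Qed.

Lemma quot_mulA (B : skewBraceType) (I : ideal B) : associative (@quot_mul B I).
Proof.
by elim/quot_piW=> a; elim/quot_piW=> b; elim/quot_piW=> c; rewrite !quot_mulE mulgA.
Qed.

Lemma quot_mul1g (B : skewBraceType) (I : ideal B) :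
  left_id (quot_one I) (@quot_mul B I).
Proof. by elim/quot_piW=> a; rewrite quot_mulE mul1g. Qed.

Lemma quot_mulg1 (B : skewBraceType) (I : ideal B) :
  right_id (quot_one I) (@quot_mul B I).
Proof. by elim/quot_piW=> a; rewrite quot_mulE mulg1. Qed.

Lemma quot_mulVg (B : skewBraceType) (I : ideal B) :
  left_inverse (quot_one I) (@quot_inv B I) (@quot_mul B I).
Proof. by elim/quot_piW=> a; rewrite quot_invE quot_mulE mulVg. Qed.

Lemma quot_mulgV (B : skewBraceType) (I : ideal B) :
  right_inverse (quot_one I) (@quot_inv B I) (@quot_mul B I).
Proof. by elim/quot_piW=> a; rewrite quot_invE quot_mulE mulgV. Qed.

HB.instance Definition _ (B : skewBraceType) (I : ideal B) :=
  isGroup.Build (quot I) (@quot_mulA B I) (@quot_mul1g B I)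
    (@quot_mulg1 B I) (@quot_mulVg B I) (@quot_mulgV B I).

Lemma quot_addA (B : skewBraceType) (I : ideal B) : associative (@quot_add B I).
Proof.
by elim/quot_piW=> a; elim/quot_piW=> b; elim/quot_piW=> c; rewrite !quot_addE sbaddA.
Qed.

Lemma quot_add0r (B : skewBraceType) (I : ideal B) :
  left_id (quot_zero I) (@quot_add B I).
Proof. by elim/quot_piW=> a; rewrite quot_addE sbadd0r. Qed.

Lemma quot_addNr (B : skewBraceType) (I : ideal B) :
  left_inverse (quot_zero I) (@quot_opp B I) (@quot_add B I).
Proof. by elim/quot_piW=> a; rewrite quot_oppE quot_addE sbaddNr. Qed.

Lemma quot_mulDr (B : skewBraceType) (I : ideal B) (a b c : quot I) :
  a * quot_add b c = quot_add (quot_add (a * b) (quot_opp a)) (a * c).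
Proof.
elim/quot_piW: a => a; elim/quot_piW: b => b; elim/quot_piW: c => c.
have mE x y : (quot_pi I x : quot I) * quot_pi I y = quot_pi I (x * y).
  exact: quot_mulE.
by rewrite quot_addE quot_oppE !mE !quot_addE sbmulDr.
Qed.

HB.instance Definition _ (B : skewBraceType) (I : ideal B) :=
  isSkewBrace.Build (quot I) (@quot_addA B I) (@quot_add0r B I)
    (@quot_addNr B I) (@quot_mulDr B I).

Definition centre (B : skewBraceType) : set B :=
  [set a | forall b, [/\ a * b = b * a, b * a = a + b & a + b = b + a]].

Lemma centre_is_ideal (B : skewBraceType) : is_ideal (@centre B).
Proof.
have C (a : B) : (forall b, [/\ b * a = a * b, a * b = a + b & b + a = a + b]) ->
    centre a.
  by move=> h b; have [-> -> ->] := h b.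
have Cm (a b : B) : centre a -> b * a = a * b by move=> /(_ b)[].
have Ca (a b : B) : centre a -> a * b = a + b by move=> /(_ b)[-> ->].
have Cd (a b : B) : centre a -> b + a = a + b by move=> /(_ b)[].
have CV (a : B) : centre a -> a^-1 = - a.
  by move=> ca; apply: sbopp_uniq; rewrite -Ca // mulgV sb1E.
have Cinv (a : B) : centre a -> centre (- a).
  move=> ca; apply: C => b; split.
  - by rewrite -CV //; apply: (mulgI a); rewrite mulgA -(Cm a b) // mulgK mulgA mulgV mul1g.
  - by rewrite -CV //; apply: (mulgI a); rewrite mulgA mulgV mul1g CV // Ca // sbaddNKr.
  - by apply: (@sbaddrI _ a); rewrite sbaddNKr sbaddA -(Cd a b) // -sbaddA sbaddrN sbaddr0.
have C0 : @centre B 0.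
  by apply: C => b; rewrite -sb1E mulg1 mul1g sb1E sbadd0r sbaddr0.
have CD (a b : B) : centre a -> centre b -> centre (a + b).
  move=> ca cb; apply: C => c; split.
  - by rewrite -Ca // -mulgA -(Cm b c) // !mulgA (Cm a).
  - by rewrite -Ca // -mulgA Ca // Ca // Ca // sbaddA.
  - by rewrite -sbaddA -(Cd b c) // !sbaddA (Cd a c).
split; first split=> //.
- by rewrite sb1E.
- by move=> x y cx cy; rewrite Ca //; apply: CD.
- by move=> x cx; rewrite CV //; apply: Cinv.
- by move=> x a cx; rewrite -sbaddA -(Cd x) // sbaddKr.
- by move=> x a cx; rewrite -mulgA -(Cm x) // mulKg.
- by move=> a x cx; rewrite /lambda Cm // Ca // -(Cd x) // sbaddKr.
Qed.

(* The ideal J of B containing I such that J / I is the centre of B / I. *)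
Definition centre_mod (B : skewBraceType) (I : ideal B) : set B :=
  quot_pi I @^-1` @centre (quot I).

Lemma centre_mod_is_ideal (B : skewBraceType) (I : ideal B) :
  is_ideal (centre_mod I).
Proof.
have [[c0 cD cN c1 cM cV] cnD cnM cl] := centre_is_ideal (quot I).
have piD a b : quot_pi I (a + b) = quot_pi I a + quot_pi I b.
  by rewrite -quot_addE.
have piN a : quot_pi I (- a) = - quot_pi I a by rewrite -quot_oppE.
have piM a b : quot_pi I (a * b) = quot_pi I a * quot_pi I b.
  by rewrite -quot_mulE.
have piV a : quot_pi I a^-1 = (quot_pi I a)^-1 by rewrite -quot_invE.
split; first split; rewrite /centre_mod /=.
- exact: c0.
- by move=> x y cx cy; rewrite piD; apply: cD.
- by move=> x cx; rewrite piN; apply: cN.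
- exact: c1.
- by move=> x y cx cy; rewrite piM; apply: cM.
- by move=> x cx; rewrite piV; apply: cV.
- by move=> x a cx; rewrite !piD piN; apply: cnD.
- by move=> x a cx; rewrite !piM piV; apply: cnM.
- by move=> a x cx; rewrite /lambda piD piN piM; apply: cl.
Qed.

Lemma zero_is_ideal (B : skewBraceType) : is_ideal [set (0 : B)].
Proof.
split; first split=> //=.
- by move=> x y -> ->; rewrite sbadd0r.
- by move=> x ->; rewrite sbopp0.
- by rewrite sb1E.
- by move=> x y -> ->; rewrite sbmulr0.
- by move=> x ->; rewrite -sb1E invg1.
- by move=> x a /= ->; rewrite sbaddr0 sbaddNr.
- by move=> x a /= ->; rewrite sbmulr0 mulVg sb1E.
- by move=> a x /= ->; rewrite lambdar0.
Qed.

Fixpoint zeta (B : skewBraceType) (n : nat) : ideal B :=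
  if n is m.+1 then Ideal (centre_mod_is_ideal (zeta B m))
  else Ideal (zero_is_ideal B).

Definition centrally_nilpotent (B : skewBraceType) : Prop :=
  exists n, ideal_set (zeta B n) = [set: B].

Definition generated_subbrace (B : skewBraceType) (X : set B) : set B :=
  smallest (@is_subbrace B) X.

Definition finitely_generated (B : skewBraceType) (S : set B) : Prop :=
  exists2 X : set B, finite_set X & S = generated_subbrace X.

Definition locally_centrally_nilpotent (B : skewBraceType) : Prop :=
  forall S : subbrace B, finitely_generated S -> centrally_nilpotent S.

Definition ascending_chain_condition (T : Type) (P : set T -> Prop) : Prop :=
  forall C : nat -> set T, (forall n, P (C n)) ->
    (forall n, C n `<=` C n.+1) ->
  exists N, forall n, (N <= n)%N -> C n = C N.

Definition i_noetherian (B : skewBraceType) : Prop :=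
  ascending_chain_condition (@is_ideal B).

Definition s_noetherian (B : skewBraceType) : Prop :=
  ascending_chain_condition (@is_subbrace B).

(* Main.v *)
(* Let [gamma n] be the lower central series of [B].
   If [B] is finitely generated and nilpotent, then commutators induce multiplicative
   homomorphisms on [gamma n / gamma n.+1] and [B / gamma n.+1] with values in the central
   section [gamma n.+1 / gamma n.+2]. Hence all these sections are finitely generated abelian
   groups, and even the subgroups of [(B, .)] satisfy the ascending chain condition.
   If [B] is i-noetherian, it is generated as an ideal by a finite set, which generates a
   subbrace [H] of some class [c]. Then [H gamma n = B] for all [n >= 1], so that
   [gamma c = gamma n] for all [n >= c]. If this term were nonzero, there would be an ideal
   [M] of [B] maximal among those properly contained in it; but a chief factor of a locally
   centrally nilpotent brace is central, so [gamma c.+1] would be contained in [M]. Hence the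
   term is zero and [B = H]. *)
From HB Require Import structures.
Require Import Defs.
From mathcomp Require Import all_boot.
From mathcomp Require Import boolp classical_sets cardinality.

Set Implicit Arguments.
Unset Strict Implicit.
Unset Printing Implicit Defensive.

Local Open Scope classical_set_scope.
Local Open Scope group_scope.
Local Open Scope brace_scope.

(* [StarL] and [StarR] are, up to conjugation, the brace products [- a + a * b - b] and
   [- b + b * a - a]. *)
Variant comm_kind := AddComm | StarL | StarR.

HB.lock Definition comm (B : skewBraceType) (k : comm_kind) (a b : B) : B :=
  match k with
  | AddComm => - (b + a) + (a + b)
  | StarL => - (a + b) + a * b
  | StarR => - (b + a) + b * a
  end.

(** * Three kinds of commutators and their behaviour modulo central elements *)

Section Commutators.
Variable B : skewBraceType.
Implicit Types (a b c x y z : B) (k : comm_kind).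

Lemma sbmul0r a : 0 * a = a.
Proof. by rewrite -sb1E mul1g. Qed.

Lemma commE k a b : comm k a b =
  match k with
  | AddComm => - (b + a) + (a + b)
  | StarL => - (a + b) + a * b
  | StarR => - (b + a) + b * a
  end.
Proof. by rewrite unlock. Qed.

Lemma comm0r k a : comm k a 0 = 0.
Proof. by rewrite commE; case: k; rewrite ?sbmulr0 ?sbmul0r ?sbadd0r ?sbaddr0 ?sbaddNr. Qed.

Lemma comm0l k a : comm k 0 a = 0.
Proof. by rewrite commE; case: k; rewrite ?sbmulr0 ?sbmul0r ?sbadd0r ?sbaddr0 ?sbaddNr. Qed.

(** The three kinds compare [a + b] with [b + a], [a * b] with [a + b], and [b * a] with [b + a];
    together they tie all four expressions to one another. *)
Lemma centreP a : centre a <-> forall k b, comm k a b = 0.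
Proof.
split=> [ca k b|ca b].
  by have [eM eD eA] := ca b; rewrite commE; case: k; rewrite ?eM ?eD ?eA sbaddNr.
have eq0 x y : - x + y = 0 -> y = x by move=> /sbopp_uniq ->; rewrite sboppK.
have := ca AddComm b; have := ca StarL b; have := ca StarR b.
rewrite !commE => /eq0 eR /eq0 eL /eq0 eA.
by rewrite eR eL eA.
Qed.

Lemma centre_addC z x : centre z -> x + z = z + x.
Proof. by case/(_ x). Qed.

Lemma centre_mulE z x : centre z -> z * x = z + x.
Proof. by case/(_ x)=> -> ->. Qed.

Lemma centre_mulC z x : centre z -> x * z = z * x.
Proof. by case/(_ x). Qed.

Lemma centre_addCA z x y : centre z -> x + (z + y) = z + (x + y).
Proof. by move=> cz; rewrite !sbaddA (centre_addC x cz). Qed.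

Lemma centre_mulDl z x y : centre z -> (z + x) * y = z + x * y.
Proof. by move=> cz; rewrite -!centre_mulE // mulgA. Qed.

Lemma centre_mulDr z x y : centre z -> x * (z + y) = z + x * y.
Proof. by move=> cz; rewrite -!centre_mulE // !mulgA (centre_mulC x cz). Qed.

Lemma centre_opp z : centre z -> centre (- z).
Proof. exact: (subbraceN (ideal_subbrace (centre_is_ideal B))). Qed.

(** * Commutators of an element of the second centre *)

Section SecondCentre.
Variable a : B.
Hypothesis comm_centre : forall k b, centre (comm k a b).

Lemma comm_addE b : a + b = comm AddComm a b + (b + a).
Proof. by rewrite -(centre_addC (b + a)) // commE sbaddNKr. Qed.

Lemma comm_starlE b : a * b = comm StarL a b + (a + b).
Proof. by rewrite -(centre_addC (a + b)) // commE sbaddNKr. Qed.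

Lemma comm_starrE b : b * a = comm StarR a b + (b + a).
Proof. by rewrite -(centre_addC (b + a)) // commE sbaddNKr. Qed.

Lemma sbaddIr x y z : y + x = z + x -> y = z.
Proof.
by move=> e; rewrite -(sbaddr0 y) -(sbaddrN x) sbaddA e -sbaddA sbaddrN sbaddr0.
Qed.

(** Apply the additive map [lambda b] to [comm_addE c]: it fixes central elements and shifts [a]
    only by the central [comm StarR a b], which cancels. *)
Lemma comm_lambda b c : comm AddComm a (lambda b c) = comm AddComm a c.
Proof.
have lz z : centre z -> lambda b z = z.
  by move=> cz; rewrite /lambda centre_mulC // centre_mulE // -(centre_addC b) // sbaddKr.
have la : lambda b a = comm StarR a b + a.
  by rewrite /lambda comm_starrE centre_addCA // sbaddKr.
have := congr1 (lambda b) (comm_addE c); rewrite !lambdaD (lz _ (comm_centre AddComm c)) la.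
rewrite -[in LHS]sbaddA (comm_addE (lambda b c)) [lambda b c + (_ + a)]centre_addCA //.
rewrite [in RHS]centre_addCA // => /sbaddrI.
exact: sbaddIr.
Qed.

(* Pitfall: [StarR] need not be additive in [b], so everything below is phrased with subgroups
   of [(B, .)] rather than with subbraces. *)
Lemma comm_mulr k b c : comm k a (b * c) = comm k a b * comm k a c.
Proof.
have addM : comm AddComm a (b * c) = comm AddComm a b + comm AddComm a c.
  apply: (@sbaddIr (b * c + a)); rewrite -comm_addE mulE_lambda.
  rewrite sbaddA comm_addE -!sbaddA (comm_addE (lambda b c)) comm_lambda.
  by rewrite !(centre_addCA _ _ (comm_centre AddComm c)) /lambda -!sbaddA.
have starrM : comm StarR a (b * c) = comm StarR a b + comm StarR a c.
  apply: (@sbaddIr (b * c + a)); rewrite -comm_starrE -mulgA (comm_starrE c).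
  rewrite centre_mulDr // sbmulDr (comm_starrE b) -!sbaddA.
  rewrite (centre_addCA (- b)) // sbaddKr !(centre_addCA _ _ (comm_centre StarR b)).
  by rewrite !(centre_addCA _ _ (comm_centre StarR c)).
rewrite [RHS]centre_mulE //; case: k => //.
apply: (@sbaddIr (a + b * c)); rewrite -comm_starlE.
rewrite mulgA comm_starlE centre_mulDl // -sbaddA; congr (_ + _).
have cN k x : centre (- comm k a x) by apply: centre_opp.
(* One side is now [(a + b) * c], which the one-sided brace law does not expand. Trading [a + b] for
   [b * a] up to central terms lets associativity carry [a] to the right, past [c]. *)
have swap x : a + x = - comm StarR a x + (comm AddComm a x + x * a).
  by rewrite comm_starrE comm_addE (centre_addCA _ _ (comm_centre AddComm x)) sbaddKr.
have swapM x : a * x = comm StarL a x + (- comm StarR a x + (comm AddComm a x + x * a)).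
  by rewrite comm_starlE -swap.
rewrite swap !centre_mulDl // -mulgA swapM !centre_mulDr // mulgA.
rewrite comm_starrE starrM (comm_addE (b * c)) addM -!sbaddA.
rewrite !(centre_addCA _ _ (comm_centre StarL c)); congr (_ + _).
rewrite !(centre_addCA _ _ (comm_centre StarR b)) sbaddNKr.
congr (_ + _).
by rewrite !(centre_addCA _ _ (comm_centre StarR c)) sbaddNKr.
Qed.

End SecondCentre.

Lemma comm_centrel k z a b : centre z -> comm k (z + a) b = comm k a b.
Proof.
move=> cz; have K x y : - (z + x) + (z + y) = - x + y.
  by rewrite sboppD -sbaddA sbaddKr.
by rewrite !commE; case: k; rewrite ?centre_mulDl ?centre_mulDr -?sbaddA ?(centre_addCA b a cz) ?K.
Qed.

Lemma comm_centrer k z a b : centre z -> comm k a (z + b) = comm k a b.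
Proof.
move=> cz; have K x y : - (z + x) + (z + y) = - x + y.
  by rewrite sboppD -sbaddA sbaddKr.
by rewrite !commE; case: k; rewrite ?centre_mulDl ?centre_mulDr -?sbaddA ?(centre_addCA a b cz) ?K.
Qed.

(** For [AddComm] and [StarR], [a * c] may be replaced by [a + c], since they differ by the central
    [comm StarL a c]. For [StarL], associativity reduces to [a * (c + b)], where the brace law
    applies. *)
Lemma comm_mull k a c b :
  (forall k b, centre (comm k a b)) -> (forall k b, centre (comm k c b)) ->
  comm k (a * c) b = comm k a b * comm k c b.
Proof.
move=> ca cc; rewrite [RHS]centre_mulE //.
have uniq x y z : centre z -> y = z + x -> - x + y = z.
  by move=> cz ->; rewrite -(centre_addC x cz) sbaddKr.
have cD j i d e : centre (comm i a d + comm j c e).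
  exact: (subbraceD (ideal_subbrace (centre_is_ideal B))).
case: k; first 2 last.
- rewrite (comm_starlE ca) comm_centrel // [LHS]commE; apply: uniq => //.
  rewrite sbmulDr (comm_starrE ca) (comm_starrE cc) -!sbaddA.
  by rewrite !(centre_addCA _ _ (cc StarR b)) sbaddKr.
- rewrite (comm_starlE ca) comm_centrel // [LHS]commE; apply: uniq => //.
  rewrite -!sbaddA (comm_addE cc) (centre_addCA a) // [a + (b + c)]sbaddA.
  by rewrite (comm_addE ca) -!sbaddA (centre_addCA (comm _ c b)).
rewrite [LHS]commE; apply: uniq => //.
rewrite -mulgA (comm_starlE cc) centre_mulDr // sbmulDr (comm_starlE ca b).
by rewrite -!sbaddA !(centre_addCA _ _ (ca StarL b)) sbaddKr.
Qed.

End Commutators.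

(** * The projection onto a quotient *)

Section QuotientMorphism.
Variables (B : skewBraceType) (I : ideal B).
Implicit Types a b : B.

Lemma quot_piM a b : quot_pi I (a * b) = quot_pi I a * quot_pi I b.
Proof. by rewrite -quot_mulE. Qed.

Lemma quot_piV a : quot_pi I a^-1 = (quot_pi I a)^-1.
Proof. by rewrite -quot_invE. Qed.

Lemma quot_piD a b : quot_pi I (a + b) = quot_pi I a + quot_pi I b.
Proof. by rewrite -quot_addE. Qed.

Lemma quot_piN a : quot_pi I (- a) = - quot_pi I a.
Proof. by rewrite -quot_oppE. Qed.

Lemma quot_pi0 : quot_pi I 0 = 0.
Proof. by []. Qed.

Lemma quot_pi1 : quot_pi I 1 = 1.
Proof. by []. Qed.

Lemma quot_piX a n : quot_pi I (a ^+ n) = quot_pi I a ^+ n.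
Proof. by elim: n => [|n IH]; rewrite ?expg0 // !expgS quot_piM IH. Qed.

Lemma quot_pi_comm k a b :
  quot_pi I (comm k a b) = comm k (quot_pi I a) (quot_pi I b).
Proof. by rewrite !commE; case: k; rewrite !(quot_piD, quot_piN, quot_piM). Qed.

Lemma quot_pi_eq0 a : quot_pi I a = 0 <-> ideal_set I a.
Proof.
rewrite -quot_pi0; split=> [/esym|Ia].
  by rewrite quot_piP sbopp0 sbadd0r.
by apply/esym; rewrite quot_piP sbopp0 sbadd0r.
Qed.

Lemma centre_modP a : centre_mod I a <-> forall k b, ideal_set I (comm k a b).
Proof.
rewrite /centre_mod /= centreP; split=> H k b.
  by apply/quot_pi_eq0; rewrite quot_pi_comm.
by elim/quot_piW: b => b; rewrite -quot_pi_comm quot_pi_eq0.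
Qed.

Lemma ideal_comm k a b : ideal_set I a -> ideal_set I (comm k a b).
Proof. by rewrite -!quot_pi_eq0 quot_pi_comm => ->; rewrite comm0l. Qed.

Lemma ideal_sub_centre_mod : ideal_set I `<=` centre_mod I.
Proof. by move=> a Ia; apply/centre_modP => k b; apply: ideal_comm. Qed.

Lemma ideal1 : ideal_set I 1. Proof. exact: subbrace1 (ideal_subbrace (ideal_setP I)). Qed.

Lemma idealM a b : ideal_set I a -> ideal_set I b -> ideal_set I (a * b).
Proof. exact: (subbraceM (ideal_subbrace (ideal_setP I))). Qed.

Lemma idealV a : ideal_set I a -> ideal_set I a^-1.
Proof. exact: (subbraceV (ideal_subbrace (ideal_setP I))). Qed.

Lemma idealJ a b : ideal_set I a -> ideal_set I (b^-1 * a * b).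
Proof. exact: (ideal_normalM (ideal_setP I)). Qed.

Lemma quot_pi_eqM a b : quot_pi I a = quot_pi I b -> ideal_set I (a^-1 * b).
Proof. by move=> e; apply/quot_pi_eq0; rewrite quot_piM quot_piV e mulVg sb1E. Qed.

End QuotientMorphism.

(** * Multiplicative subgroups above an ideal *)

Record is_mulgrp (B : skewBraceType) (S : set B) : Prop := IsMulgrp {
  mulgrp1 : S 1;
  mulgrpM : forall x y, S x -> S y -> S (x * y);
  mulgrpV : forall x, S x -> S x^-1
}.

Lemma subbrace_mulgrp (B : skewBraceType) (S : set B) : is_subbrace S -> is_mulgrp S.
Proof. by case. Qed.

Lemma ideal_mulgrp (B : skewBraceType) (I : ideal B) : is_mulgrp (ideal_set I).
Proof. exact: subbrace_mulgrp (ideal_subbrace (ideal_setP I)). Qed.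

Section MulGroups.
Variable B : skewBraceType.
Implicit Types (I J : ideal B) (S T : set B).

(** A multiplicative subgroup containing [I] is a union of cosets of [I], so closure properties can
    be checked in the quotient. *)
Lemma mulgrp_congr I T a b :
  is_mulgrp T -> ideal_set I `<=` T -> quot_pi I a = quot_pi I b -> T a -> T b.
Proof.
move=> Tg IT /quot_pi_eqM e Ta; rewrite -(mulVKg a b).
by apply: (mulgrpM Tg) => //; apply: IT.
Qed.

(* Modulo [I], the elements of [T] are central, so on them both group laws agree. *)
Lemma central_mulgrp_ideal I T :
  is_mulgrp T -> ideal_set I `<=` T -> T `<=` centre_mod I -> is_ideal T.
Proof.
move=> Tg IT TC.
have cp x : T x -> centre (quot_pi I x) by move/TC.
have TN x : T x -> T (- x).
  move=> Tx; apply: (mulgrp_congr Tg IT _ (mulgrpV Tg Tx)).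
  rewrite quot_piN quot_piV; apply: sbopp_uniq.
  by rewrite -centre_mulE ?mulgV ?sb1E //; apply: cp.
have T1 := mulgrp1 Tg.
split; first split=> //.
- by rewrite -sb1E.
- move=> x y Tx Ty; apply: (mulgrp_congr Tg IT _ (mulgrpM Tg Tx Ty)).
  by rewrite quot_piM quot_piD centre_mulE //; apply: cp.
- exact: mulgrpM.
- exact: mulgrpV.
- move=> x a Tx; apply: (mulgrp_congr Tg IT _ Tx).
  by rewrite !quot_piD quot_piN -sbaddA -(centre_addC _ (cp _ Tx)) sbaddKr.
- move=> x a Tx; apply: (mulgrp_congr Tg IT _ Tx).
  by rewrite !quot_piM quot_piV -mulgA -(centre_mulC _ (cp _ Tx)) mulKg.
- move=> a x Tx; apply: (mulgrp_congr Tg IT _ Tx).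
  rewrite /lambda quot_piD quot_piM quot_piN (centre_mulC _ (cp _ Tx)).
  by rewrite centre_mulE -?(centre_addC _ (cp _ Tx)) ?sbaddKr //; apply: cp.
Qed.

End MulGroups.

(** * Generated subbraces, multiplicative subgroups and ideals *)

Section Smallest.
Variable B : skewBraceType.
Implicit Type X : set B.

Lemma smallest_subbrace X : is_subbrace (smallest (@is_subbrace B) X).
Proof.
split=> [S [[]]|x y Sx Sy S SX|x Sx S SX|S [[]]|x y Sx Sy S SX|x Sx S SX] //;
  have [[s0 sD sN s1 sM sV] _] := SX;
  by [apply: sD; [apply: Sx|apply: Sy]|apply: sN; apply: Sx
     |apply: sM; [apply: Sx|apply: Sy]|apply: sV; apply: Sx].
Qed.

Lemma smallest_mulgrp X : is_mulgrp (smallest (@is_mulgrp B) X).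
Proof.
split=> [S [[]]|x y Sx Sy S SX|x Sx S SX] //; have [[s1 sM sV] _] := SX.
  by apply: sM; [apply: Sx|apply: Sy].
by apply: sV; apply: Sx.
Qed.

Lemma smallest_ideal X : is_ideal (smallest (@is_ideal B) X).
Proof.
split; first split=> [S [[[]]]|x y Sx Sy S SX|x Sx S SX|S [[[]]]|x y Sx Sy S SX|x Sx S SX] //.
- by have [[sb _ _ _] _] := SX; apply: (subbraceD sb); [apply: Sx|apply: Sy].
- by have [[sb _ _ _] _] := SX; apply: (subbraceN sb); apply: Sx.
- by have [[sb _ _ _] _] := SX; apply: (subbraceM sb); [apply: Sx|apply: Sy].
- by have [[sb _ _ _] _] := SX; apply: (subbraceV sb); apply: Sx.
- by move=> x a Sx S SX; apply: (ideal_normalD SX.1); apply: Sx.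
- by move=> x a Sx S SX; apply: (ideal_normalM SX.1); apply: Sx.
- by move=> a x Sx S SX; apply: (ideal_lambda SX.1); apply: Sx.
Qed.

End Smallest.

(** * Consequences of an ascending chain condition *)

Section AscendingChains.
Variable T : Type.
Implicit Types (P Q : set T -> Prop) (C : nat -> set T).

Lemma chain_sub C m n : (forall i, C i `<=` C i.+1) -> (m <= n)%N -> C m `<=` C n.
Proof.
move=> CS /subnK <-; elim: (n - m)%N => [|k IH] //.
by apply: subset_trans IH _; apply: CS.
Qed.

Lemma acc_maximal P Q :
  ascending_chain_condition P -> (exists2 A, P A & Q A) ->
  exists M, [/\ P M, Q M & forall S, P S -> Q S -> M `<=` S -> S `<=` M].
Proof.
move=> acc [A0 PA0 QA0]; apply: contrapT => nomax.
(* The implication makes the statement total, so that [choice] applies; where [P] or [Q] fails, the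
   value is the dummy [S]. *)
have step S : exists S', P S /\ Q S -> [/\ P S', Q S', S `<=` S' & ~ S' `<=` S].
  have [[PS QS]|nPQ] := pselect (P S /\ Q S); last by exists S.
  apply: contrapT => noS'; apply: nomax; exists S; split=> // S' PS' QS' SS'.
  by apply: contrapT => nS'S; apply: noS'; exists S'.
have [f fP] := choice step.
pose C n := iter n f A0.
have CPQ n : P (C n) /\ Q (C n) by elim: n => [|n /fP[]].
have [||N NP] := acc C; first by move=> n; case: (CPQ n).
  by move=> n; have [] := fP _ (CPQ n).
by have [_ _ _] := fP _ (CPQ N); apply; rewrite -[f _]/(C N.+1) (NP N.+1).
Qed.

(** Among the closures of finite subsets of [A], a maximal one absorbs every further point of
    [A]. *)
Lemma acc_finite_generation P A :
  ascending_chain_condition P -> (forall X, P (smallest P X)) ->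
  exists F, [/\ finite_set F, F `<=` A & forall S, P S -> F `<=` S -> A `<=` S].
Proof.
move=> acc Psm.
pose Q M := exists F, [/\ finite_set F, F `<=` A & M = smallest P F].
have [|M [PM [F [finF FA eM]] maxM]] := acc_maximal (Q := Q) acc.
  by exists (smallest P set0); [exact: Psm|exists set0; split=> //; exact: sub0set].
exists F; split=> // S PS FS x Ax.
suff Mx : M x by apply: (smallest_sub PS FS); rewrite -eM.
apply: (maxM (smallest P (F `|` [set x]))); first exact: Psm.
- exists (F `|` [set x]); split=> //; first by rewrite finite_setU.
  by rewrite subUset; split=> // y ->.
- by rewrite eM; apply: sub_smallest2r => //; apply: subsetUl.
- by apply: sub_gen_smallest; right.
Qed.

End AscendingChains.

(** * Chain conditions for multiplicative subgroups of a section *)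

Section AccBetween.
Variable B : skewBraceType.
Implicit Types (I J : ideal B) (K S : set B).

Definition mulgrp_between J K S := [/\ is_mulgrp S, ideal_set J `<=` S & S `<=` K].

Definition acc_between J K := ascending_chain_condition (mulgrp_between J K).

(** The traces [D n] of the chain on [I] and its products [E n] with [I] both stabilise. By the
    modular law, nested subgroups with equal trace and equal product coincide. *)
Lemma acc_between_trans J I K :
  ideal_set J `<=` ideal_set I -> ideal_set I `<=` K -> is_mulgrp K ->
  acc_between J (ideal_set I) -> acc_between I K -> acc_between J K.
Proof.
move=> JI IK Kg accJI accIK C Cb CS.
have Cg n : is_mulgrp (C n) by case: (Cb n).
have CK n : C n `<=` K by case: (Cb n).
pose D n := C n `&` ideal_set I.
(* This is the product of [C n] with [I], since [I] is closed under inverses. *)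
pose E n := [set g | exists2 i, ideal_set I i & C n (g * i)].
have [||N1 N1P] := accJI D.
- move=> n; split=> [|x Jx|x []] //; last by split; [case: (Cb n) => _ + _; apply|apply: JI].
  split=> [|x y [Cx Ix] [Cy Iy]|x [Cx Ix]]; split.
  + exact: mulgrp1.
  + exact: ideal1.
  + exact: mulgrpM.
  + exact: idealM.
  + exact: mulgrpV.
  + exact: idealV.
- by move=> n x [Cx Ix]; split=> //; apply: CS.
have [||N2 N2P] := accIK E.
- move=> n; split=> [|x Ix|x [i Ii Ci]].
  + split=> [|x y [i Ii Ci] [j Ij Cj]|x [i Ii Ci]].
    * by exists 1; [apply: ideal1|rewrite mulg1; apply: mulgrp1].
    * exists ((y^-1 * i * y) * j); first by apply: idealM => //; apply: idealJ.
      by rewrite -!mulgA (mulgA i) !mulgA mulgK -(mulgA _ y j); apply: mulgrpM.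
    * exists (x * i^-1 * x^-1).
        by rewrite -{1}(invgK x); apply: idealJ; apply: idealV.
      by rewrite !mulgA mulVg mul1g -invgM; apply: mulgrpV.
  + by exists x^-1; [apply: idealV|rewrite mulgV; apply: mulgrp1].
  + rewrite -(mulgK i x); apply: (mulgrpM Kg); first exact: CK Ci.
    by apply: (mulgrpV Kg); apply: IK.
- by move=> n x [i Ii Ci]; exists i => //; apply: CS.
exists (maxn N1 N2) => n; rewrite geq_max => /andP[N1n N2n].
set m := maxn N1 N2; have mn : (m <= n)%N by rewrite geq_max N1n.
apply/seteqP; split; last exact: chain_sub.
move=> x Cx; have [i Ii Ci] : E m x.
  rewrite N2P ?leq_maxr // -(N2P n) //; exists 1; [exact: ideal1|by rewrite mulg1].
have : D n i.
  split=> //; rewrite -(mulKg x i); apply: (mulgrpM (Cg n)); first exact: mulgrpV.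
  exact: chain_sub Ci.
rewrite N1P // -(N1P m) ?leq_maxl // => -[Cmi _].
by rewrite -(mulgK i x); apply: (mulgrpM (Cg m)) => //; apply: mulgrpV.
Qed.

(** The exponents occurring anywhere in the chain are the multiples of the least positive one, [d];
    all of them are present as soon as [y ^+ d] is. If no positive exponent occurs, only [y ^+ 0]
    counts. *)
Lemma acc_exponents (C : nat -> set B) (y : B) :
  (forall n, is_mulgrp (C n)) -> (forall n, C n `<=` C n.+1) ->
  exists N, forall n k, C n (y ^+ k) -> C N (y ^+ k).
Proof.
move=> Cg CS.
pose U k := `[< (0 < k)%N /\ exists n, C n (y ^+ k) >].
have [exU|noU] := pselect (exists k, U k); last first.
  exists 0%N => n [|k] Ck; first by rewrite expg0; apply: mulgrp1.
  by case: noU; exists k.+1; apply/asboolP; split=> //; exists n.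
have [d /asboolP[d0 [N CN]] dmin] := ex_minnP exU.
exists N => n k Ck.
have Cd j i : C j (y ^+ d) -> C j (y ^+ (i * d)).
  move=> Cd; elim: i => [|i IH]; first by rewrite mul0n expg0; apply: mulgrp1.
  by rewrite mulSn expgnDr; apply: mulgrpM.
have [r0|r0] := posnP (k %% d).
  by rewrite (divn_eq k d) r0 addn0; apply: Cd.
have : U (k %% d).
  apply/asboolP; split=> //; exists (maxn n N).
  have -> : y ^+ (k %% d) = (y ^+ (k %/ d * d))^-1 * y ^+ k.
    by rewrite [in y ^+ k](divn_eq k d) expgnDr mulKg.
  apply: (mulgrpM (Cg _)); last by apply: chain_sub Ck => //; apply: leq_maxl.
  apply: (mulgrpV (Cg _)); apply: Cd.
  by apply: chain_sub CN => //; apply: leq_maxr.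
by move=> /dmin; rewrite leqNgt ltn_mod d0.
Qed.

(** Modulo [I] the section is cyclic, so a member of the chain is determined by the powers of [y]
    that it contains. *)
Lemma acc_cyclic I y :
  centre_mod I y -> acc_between I (smallest (@is_mulgrp B) (ideal_set I `|` [set y])).
Proof.
move=> cy C Cb CS.
have Cg n : is_mulgrp (C n) by case: (Cb n).
have IC n : ideal_set I `<=` C n by case: (Cb n).
(* Powers have natural exponents, so the pair [m], [n] encodes the integer exponent [n - m]. *)
pose E := [set g | exists m n, quot_pi I g * quot_pi I y ^+ m = quot_pi I y ^+ n].
have cyX n (q : quot I) : commute (quot_pi I y ^+ n) q.
  by apply: commute_sym; apply: commuteX; apply: centre_mulC.
have Eg : is_mulgrp E.
  split.
  - by exists 0%N, 0%N; rewrite quot_pi1 !expg0 mulg1.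
  - move=> g h [m [n e]] [m' [n' e']]; exists (m + m')%N, (n + n')%N.
    rewrite quot_piM !expgnDr -mulgA (mulgA (quot_pi I h)) -(cyX m) -mulgA e'.
    by rewrite mulgA e.
  - move=> g [m [n e]]; exists n, m.
    by rewrite quot_piV -e mulKg.
have CE n : C n `<=` E.
  case: (Cb n) => _ _ /subset_trans; apply; apply: smallest_sub => // x.
  move=> [Ix|->]; last by exists 0%N, 1%N; rewrite expg0 expg1 mulg1.
  exists 0%N, 0%N; rewrite !expg0 mulg1.
  by move/quot_pi_eq0: Ix => ->; rewrite sb1E.
have [N NP] := acc_exponents y Cg CS.
exists N => n Nn; apply/seteqP; split; last exact: chain_sub.
move=> g Cng; have [m [k e]] := CE _ _ Cng.
have congr a b j : quot_pi I a = quot_pi I b -> C j a -> C j b.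
  by apply: mulgrp_congr.
have [mk|/ltnW km] := leqP m k.
  have eg : quot_pi I g = quot_pi I (y ^+ (k - m)).
    apply: (mulIg (quot_pi I y ^+ m)).
    by rewrite e (quot_piX I y (k - m)) -expgnDr subnK.
  by apply: (congr _ _ _ (esym eg)); apply: (NP n); apply: (congr _ _ _ eg).
have eg : quot_pi I g^-1 = quot_pi I (y ^+ (m - k)).
  apply: (mulgI (quot_pi I g)); rewrite quot_piV mulgV.
  apply: (mulIg (quot_pi I y ^+ k)).
  by rewrite mul1g (quot_piX I y (m - k)) -mulgA -expgnDr subnK // e.
rewrite -(invgK g); apply: (mulgrpV (Cg N)).
apply: (congr _ _ _ (esym eg)); apply: (NP n); apply: (congr _ _ _ eg).
exact: mulgrpV.
Qed.

Lemma centre_mod_mono I J : ideal_set I `<=` ideal_set J -> centre_mod I `<=` centre_mod J.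
Proof. by move=> IJ a /centre_modP H; apply/centre_modP => k b; apply: IJ. Qed.

(** Induction on the generators: by centrality, adjoining [y] to [I] gives an ideal again, and this
    first step is cyclic. Generation is stated relative to [I] so that it passes to the larger
    ideal. *)
Lemma acc_central_fg I K (ys : seq B) :
  is_mulgrp K -> ideal_set I `<=` K -> K `<=` centre_mod I ->
  (forall y, y \in ys -> K y) ->
  (forall S, is_mulgrp S -> ideal_set I `<=` S -> (forall y, y \in ys -> S y) -> K `<=` S) ->
  acc_between I K.
Proof.
move=> Kg; elim: ys I => [|y ys IH] I IK KC ysK Kgen.
  move=> C Cb CS; exists 0%N => n _; have [[Cg IC CK] [Cg0 IC0 CK0]] := (Cb n, Cb 0%N).
  have KS S : is_mulgrp S -> ideal_set I `<=` S -> K `<=` S by move=> *; apply: Kgen.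
  by apply/seteqP; split; [apply: subset_trans CK _|apply: subset_trans CK0 _]; apply: KS.
pose L := smallest (@is_mulgrp B) (ideal_set I `|` [set y]).
have Lg : is_mulgrp L by apply: smallest_mulgrp.
have IL : ideal_set I `<=` L by apply: sub_smallest; apply: subsetUl.
have LK : L `<=` K.
  by apply: smallest_sub => // x [/IK //|->]; apply: ysK; rewrite mem_head.
have Li := central_mulgrp_ideal Lg IL (subset_trans LK KC).
apply: (@acc_between_trans I (Ideal Li)) => //.
  by apply: acc_cyclic; apply: KC; apply: ysK; rewrite mem_head.
apply: IH => //.
- by apply: subset_trans KC _; apply: centre_mod_mono.
- by move=> z zs; apply: ysK; rewrite inE zs orbT.
- move=> S Sg LS ysS; apply: Kgen => //; first exact: subset_trans LS.
  move=> z; rewrite inE => /orP[/eqP ->|/ysS //].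
  by apply: LS; apply: sub_gen_smallest; right.
Qed.

Lemma acc_between_fg I A :
  acc_between I [set: B] ->
  exists F, [/\ finite_set F, F `<=` A &
    forall S, is_mulgrp S -> ideal_set I `<=` S -> F `<=` S -> A `<=` S].
Proof.
move=> acc; have [X|F [finF FA Fgen]] := acc_finite_generation A acc.
  split=> // [|x Ix S [[_ + _] _]]; last exact.
  split=> [S [[[]]]|x y Sx Sy S SX|x Sx S SX] //; have [[Sg _ _] _] := SX.
    by apply: mulgrpM => //; [apply: Sx|apply: Sy].
  by apply: mulgrpV => //; apply: Sx.
by exists F; split=> // S Sg IS FS; apply: Fgen.
Qed.

End AccBetween.

(** * Lower and upper central series *)

Section CentralSeries.
Variable B : skewBraceType.
Implicit Types (I J : ideal B) (S : set B).

Lemma setT_is_ideal : is_ideal [set: B].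
Proof. by split=> //; split. Qed.

(** Indexing starts with [gamma 0] equal to [B]. Taking only the first argument from [gamma m] loses
    nothing, since [StarL] and [StarR] cover both orders of the product. *)
Fixpoint gamma (n : nat) : ideal B :=
  if n is m.+1 then
    Ideal (smallest_ideal
      [set x | exists k a b, ideal_set (gamma m) a /\ x = comm k a b])
  else Ideal setT_is_ideal.

Lemma gamma_comm n k a b :
  ideal_set (gamma n) a -> ideal_set (gamma n.+1) (comm k a b).
Proof. by move=> Ga; apply: sub_gen_smallest; exists k, a, b. Qed.

Lemma gamma_min n S : is_ideal S ->
  (forall k a b, ideal_set (gamma n) a -> S (comm k a b)) ->
  ideal_set (gamma n.+1) `<=` S.
Proof. by move=> Si SC; apply: smallest_sub => // x [k [a [b [Ga ->]]]]; apply: SC. Qed.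

Lemma gammaS_sub n : ideal_set (gamma n.+1) `<=` ideal_set (gamma n).
Proof. by apply: gamma_min; [exact: ideal_setP|move=> k a b; apply: ideal_comm]. Qed.

Lemma gamma_centre_mod n : ideal_set (gamma n) `<=` centre_mod (gamma n.+1).
Proof. by move=> a Ga; apply/centre_modP => k b; apply: gamma_comm. Qed.

(* Every subgroup of [(B, .)] between consecutive terms is an ideal, so [gamma n.+1] is
   reached from [gamma n.+2] by multiplication alone. *)
Lemma gamma_mulgrp_min n S : is_mulgrp S -> ideal_set (gamma n.+2) `<=` S ->
  (forall k a b, ideal_set (gamma n) a -> S (comm k a b)) ->
  ideal_set (gamma n.+1) `<=` S.
Proof.
move=> Sg GS SC; pose T := S `&` ideal_set (gamma n.+1).
have Tg : is_mulgrp T.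
  split=> [|x y [Sx Gx] [Sy Gy]|x [Sx Gx]]; split.
  - exact: mulgrp1.
  - exact: ideal1.
  - exact: mulgrpM.
  - exact: idealM.
  - exact: mulgrpV.
  - exact: idealV.
have GT : ideal_set (gamma n.+2) `<=` T.
  by move=> x Gx; split; [apply: GS|apply: gammaS_sub].
have Ti : is_ideal T.
  by apply: (central_mulgrp_ideal Tg GT) => x [_ Gx]; apply: gamma_centre_mod.
have /subset_trans : ideal_set (gamma n.+1) `<=` T.
  by apply: gamma_min => // k a b Ga; split; [apply: SC|apply: gamma_comm].
by apply=> x [].
Qed.

Lemma comm_congr I k a a' b b' :
  quot_pi I a = quot_pi I a' -> quot_pi I b = quot_pi I b' ->
  quot_pi I (comm k a b) = quot_pi I (comm k a' b').
Proof. by rewrite !quot_pi_comm => -> ->. Qed.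

Lemma comm_centre_mod I k a b c d : centre_mod I c -> centre_mod I d ->
  quot_pi I (comm k (a * c) (b * d)) = quot_pi I (comm k a b).
Proof.
rewrite /centre_mod /= => cc cd; rewrite !quot_pi_comm !quot_piM.
rewrite (centre_mulC _ cc) (centre_mulC _ cd) !centre_mulE //.
by rewrite comm_centrel // comm_centrer.
Qed.

(** The preimage in [B] of the upper central series of [B / I]; keeping it inside [B] allows
    comparison for different [I]. *)
Fixpoint zeta_over I n : ideal B :=
  if n is m.+1 then Ideal (centre_mod_is_ideal (zeta_over I m)) else I.

Lemma zeta_overE n : zeta_over (Ideal (zero_is_ideal B)) n = zeta B n.
Proof. by elim: n => //= n ->. Qed.

Lemma sub_zeta_over I n : ideal_set I `<=` ideal_set (zeta_over I n).
Proof.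
by elim: n => //= n IH; apply: subset_trans IH _; apply: ideal_sub_centre_mod.
Qed.

Lemma zeta_over_mono I J n : ideal_set I `<=` ideal_set J ->
  ideal_set (zeta_over I n) `<=` ideal_set (zeta_over J n).
Proof. by move=> IJ; elim: n => //= n IH; apply: centre_mod_mono. Qed.

(** A commutator falls one step in the upper series, so [gamma k] lies in [zeta_over I (n - k)]. *)
Lemma gamma_sub_zeta_over I n :
  ideal_set (zeta_over I n) = [set: B] -> ideal_set (gamma n) `<=` ideal_set I.
Proof.
move=> zT; have H k : (k <= n)%N -> ideal_set (gamma k) `<=` ideal_set (zeta_over I (n - k)).
  elim: k => [|k IH] kn; first by rewrite subn0 zT.
  apply: gamma_min; first exact: ideal_setP.
  move=> j a b /(IH (ltnW kn)); rewrite -(subnSK kn) /= => /centre_modP.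
  exact.
by have := H n (leqnn n); rewrite subnn.
Qed.

(** Induction on [n], adding one central section at a time, for which finite generation suffices.
    The induction hypothesis itself supplies the finite sets [U] and [V] whose commutators generate
    the next section. *)
Lemma acc_gamma X n : finite_set X -> [set: B] = generated_subbrace X ->
  acc_between (gamma n) [set: B].
Proof.
move=> finX genX.
have Tg : is_mulgrp [set: B] by [].
have acc0 : acc_between (gamma 0) [set: B].
  move=> C Cb _; exists 0%N => m _; have CT i : C i = [set: B].
    by apply/seteqP; split=> // x _; case: (Cb i) => _ + _; apply.
  by rewrite !CT.
have fg S : finite_set S -> exists s : seq B, S = [set` s] by move/finite_seqP.
elim: n => // n IH.
apply: (acc_between_trans (@gammaS_sub n) _ Tg _ IH) => //.
have gG : is_mulgrp (ideal_set (gamma n)) by apply: ideal_mulgrp.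
have GC : ideal_set (gamma n) `<=` centre_mod (gamma n.+1) by apply: gamma_centre_mod.
have fgn : exists Y, [/\ finite_set Y, Y `<=` ideal_set (gamma n) &
    forall S, is_mulgrp S -> ideal_set (gamma n.+1) `<=` S -> Y `<=` S ->
      ideal_set (gamma n) `<=` S].
  case: n IH gG GC => [|n] IH gG GC.
    (* [X] generates [B] only as a brace, but a multiplicative subgroup above [gamma 1] is an ideal,
       hence a subbrace. *)
    exists X; split=> // S Sg GS XS; rewrite [X in X `<=` _]genX.
    apply: smallest_sub XS; apply: ideal_subbrace.
    by apply: (central_mulgrp_ideal Sg GS) => x _; apply: gamma_centre_mod.
  have [U [finU _ genU]] := acc_between_fg [set: B] IH.
  have [V [finV VG genV]] := acc_between_fg (ideal_set (gamma n)) IH.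
  pose Y := [set x | exists k v u, [/\ V v, U u & x = comm k v u]].
  exists Y; split.
  - have [[u eU] [v eV]] := (fg _ finU, fg _ finV).
    apply/finite_seqP; exists
      (flatten [seq [seq comm k a b | a <- v, b <- u] | k <- [:: AddComm; StarL; StarR]]).
    apply/seteqP; split=> x /=.
      move=> [k [a [b [Va Ub ->]]]]; rewrite !mem_cat.
      have ab : comm k a b \in [seq comm k a b | a <- v, b <- u].
        by apply: allpairs_f; [move: Va; rewrite eV|move: Ub; rewrite eU].
      by case: k ab => ->; rewrite ?orbT.
    have Yk k : x \in [seq comm k a b | a <- v, b <- u] -> Y x.
      move=> /allpairsP[[a b] /= [av bu ->]]; exists k, a, b; split=> //.
        by rewrite eV.
      by rewrite eU.
    by rewrite !mem_cat => /or4P[/Yk|/Yk|/Yk|] //.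
  - by move=> x [k [v [u [/VG Gv _ ->]]]]; apply: gamma_comm.
  - move=> S Sg GS YS.
    have Sc x y : quot_pi (gamma n.+2) x = quot_pi (gamma n.+2) y -> S x -> S y.
      exact: mulgrp_congr.
    (* Modulo [gamma n.+2], elements of [gamma n] lie in the second centre, so [comm_mulr] and
       [comm_mull] apply there. *)
    have cG k a b : ideal_set (gamma n) a ->
        centre (comm k (quot_pi (gamma n.+2) a) (quot_pi (gamma n.+2) b)).
      by move=> Ga; rewrite -quot_pi_comm; apply: gamma_centre_mod; apply: gamma_comm.
    have cG' a : ideal_set (gamma n) a ->
        forall k q, centre (comm k (quot_pi (gamma n.+2) a) q).
      by move=> Ga k q; elim/quot_piW: q => b; apply: cG.
    have Vb v b : V v -> forall k, S (comm k v b).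
      move=> Vv; pose R := [set b | forall k, S (comm k v b)].
      have Gv := VG _ Vv.
      have Mr k x y : quot_pi (gamma n.+2) (comm k v (x * y)) =
          quot_pi (gamma n.+2) (comm k v x * comm k v y).
        by rewrite quot_piM !quot_pi_comm quot_piM comm_mulr //; apply: cG'.
      have Rg : is_mulgrp R.
        split=> [k|x y Rx Ry k|x Rx k].
        + by rewrite sb1E comm0r -sb1E; apply: mulgrp1.
        + by apply: (Sc _ _ (esym (Mr k x y))); apply: mulgrpM.
        + apply: (Sc (comm k v x)^-1 _); last exact: mulgrpV.
          have := Mr k x x^-1; rewrite mulgV sb1E comm0r -sb1E quot_piM quot_piV => e.
          by apply: (mulgI (quot_pi (gamma n.+2) (comm k v x))); rewrite mulgV -e.
      suff : [set: B] `<=` R by apply.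
      apply: genU => // x; last by move=> Ux k; apply: YS; exists k, v, x.
      (* An element of [gamma n.+1] is central modulo [gamma n.+2], so it may be replaced by [1]. *)
      move=> /gamma_centre_mod Gx k; apply: (Sc (comm k v 1)); last first.
        by rewrite sb1E comm0r -sb1E; apply: mulgrp1.
      have := @comm_centre_mod (gamma n.+2) k v 1 1 x; rewrite !mulg1 mul1g => ->//.
      by apply: ideal_sub_centre_mod; apply: ideal1.
    apply: gamma_mulgrp_min => // k a b.
    (* Now the first argument varies; [R] carries membership in [gamma n] because [Ml] requires it
       of both factors. *)
    pose R := [set a | ideal_set (gamma n) a /\ forall k b, S (comm k a b)].
    suff : ideal_set (gamma n) `<=` R by move=> GR /GR[].
    have Ml i x y z : ideal_set (gamma n) x -> ideal_set (gamma n) y ->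
        quot_pi (gamma n.+2) (comm i (x * y) z) =
        quot_pi (gamma n.+2) (comm i x z * comm i y z).
      by move=> Gx Gy; rewrite quot_piM !quot_pi_comm quot_piM comm_mull //; apply: cG'.
    have Rg : is_mulgrp R.
      split=> [|x y [Gx Rx] [Gy Ry]|x [Gx Rx]]; split.
      + exact: ideal1.
      + by move=> i c; rewrite sb1E comm0l -sb1E; apply: mulgrp1.
      + exact: idealM.
      + by move=> i c; apply: (Sc _ _ (esym (Ml i x y c Gx Gy))); apply: mulgrpM.
      + exact: idealV.
      + move=> i c; apply: (Sc (comm i x c)^-1 _); last exact: mulgrpV.
        have := Ml i x x^-1 c Gx (idealV Gx).
        rewrite mulgV sb1E comm0l -sb1E quot_piM quot_piV => e.
        by apply: (mulgI (quot_pi (gamma n.+2) (comm i x c))); rewrite mulgV -e.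
    apply: genV => // x; last by move=> Vx; split=> [|i c]; [apply: VG|apply: Vb].
    move=> Gx; split=> [|i c]; first exact: gammaS_sub.
    by apply: GS; apply: gamma_comm.
have [Y [finY YG genY]] := fgn; have [s eY] := fg _ finY.
apply: (@acc_central_fg _ _ _ s) => //.
- exact: gammaS_sub.
- by move=> y ys; apply: YG; rewrite eY.
- by move=> S Sg GS sS; apply: genY => // y; rewrite eY; apply: sS.
Qed.

End CentralSeries.

(** * From finite generation and nilpotency to the chain condition on subbraces *)

Lemma fg_nilpotent_s_noetherian (B : skewBraceType) :
  finitely_generated [set: B] -> centrally_nilpotent B -> s_noetherian B.
Proof.
move=> [X finX genX] [c zT] C Csb CS.
have Gc : ideal_set (gamma B c) `<=` [set 0].
  by apply: (@gamma_sub_zeta_over _ (Ideal (zero_is_ideal B))); rewrite zeta_overE.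
have acc := @acc_gamma _ _ c finX genX.
apply: (acc C) => // n; split=> //; first exact: subbrace_mulgrp.
by apply: subset_trans Gc _ => x ->; apply: subbrace0.
Qed.

(** * Subbraces that supplement an ideal *)

Section Supplement.
Variables (B : skewBraceType) (H : subbrace B).
Implicit Types I : ideal B.

(** The product of [H] and [I], described as a union of cosets of [I]. *)
Definition supplement_set I : set B :=
  [set b | exists h : H, quot_pi I (val h) = quot_pi I b].

Definition supplements I := forall b, supplement_set I b.

Lemma supplement_set_mulgrp I : is_mulgrp (supplement_set I).
Proof.
split=> [|x y [h eh] [i ei]|x [h eh]].
- by exists 1.
- by exists (h * i); rewrite /= !quot_piM eh ei.
- by exists h^-1; rewrite /= !quot_piV eh.
Qed.

Lemma sub_supplement_set I : ideal_set I `<=` supplement_set I.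
Proof. by move=> x /quot_pi_eq0 e; exists 0; rewrite e. Qed.

Lemma val_comm k (u v : H) : val (comm k u v) = comm k (val u) (val v).
Proof. by rewrite !commE; case: k. Qed.

(** Centrality has to be tested against all of [B], but modulo [I] every element of [B] comes from
    [H]. *)
Lemma zeta_supplement I n (u : H) : supplements I ->
  ideal_set (zeta H n) u -> ideal_set (zeta_over I n) (val u).
Proof.
move=> HI; elim: n u => [u /= ->|n IH u /centre_modP zu] /=.
  by rewrite -sb1E; apply: ideal1.
apply/centre_modP => k b; have [h e] := HI b.
have := IH _ (zu k h); rewrite val_comm.
apply: mulgrp_congr; [exact: ideal_mulgrp|exact: sub_zeta_over|exact: comm_congr].
Qed.

(** As for groups, covering the quotient by [gamma B 1] forces covering the later ones:
    [gamma B n.+1] is generated modulo [gamma B n.+2] by commutators, and these depend only on the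
    [H]-parts of their arguments. *)
Lemma supplements_gamma n : supplements (gamma B 1) -> supplements (gamma B n.+1).
Proof.
move=> H1; elim: n => // n IH b.
have Sg := supplement_set_mulgrp (gamma B n.+2).
have decomp x : exists (h : H) c, ideal_set (gamma B n.+1) c /\ x = val h * c.
  have [h /quot_pi_eqM e] := IH x.
  by exists h, ((val h)^-1 * x); rewrite mulVKg.
suff GnS : ideal_set (gamma B n.+1) `<=` supplement_set (gamma B n.+2).
  have [h [c [Gc ->]]] := decomp b; apply: (mulgrpM Sg); last exact: GnS.
  by exists h.
apply: gamma_mulgrp_min => // [|k x y _]; first exact: sub_supplement_set.
have [h [c [/gamma_centre_mod Gc ->]]] := decomp x.
have [i [d [/gamma_centre_mod Gd ->]]] := decomp y.
by exists (comm k h i); rewrite val_comm comm_centre_mod.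
Qed.

End Supplement.

(** * Chief factors of locally centrally nilpotent braces *)

(* An ideal-membership certificate involves only finitely many elements of [B]. *)
Lemma smallest_ideal_local (B : skewBraceType) (Y : set B) (a : B) :
  smallest (@is_ideal B) Y a ->
  exists2 F, finite_set F & forall (H : subbrace B) (K : ideal H),
    F `<=` subbrace_set H -> (forall u : H, Y (val u) -> ideal_set K u) ->
    exists2 u : H, ideal_set K u & val u = a.
Proof.
pose L := [set a | exists2 F, finite_set F & forall (H : subbrace B) (K : ideal H),
    F `<=` subbrace_set H -> (forall u : H, Y (val u) -> ideal_set K u) ->
    exists2 u : H, ideal_set K u & val u = a].
have /smallest_sub LS : is_ideal L; last first.
  apply: LS => x Yx.
  exists [set x] => // H K /(_ x erefl) Hx YK.
  by exists (sub_elt Hx) => //; apply: YK.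
have L0 : L 0.
  exists set0 => // H K _ _; exists 0 => //.
  exact: (subbrace0 (ideal_subbrace (ideal_setP K))).
have Lop1 (op : B -> B) :
    (forall (H : subbrace B) (K : ideal H) u, ideal_set K u ->
       exists2 v : H, ideal_set K v & val v = op (val u)) ->
    forall x, L x -> L (op x).
  move=> opP x [F finF FP]; exists F => // H K FH YK.
  by have [u Ku <-] := FP H K FH YK; apply: opP.
have Lop2 (op : B -> B -> B) :
    (forall (H : subbrace B) (K : ideal H) u v, ideal_set K u -> ideal_set K v ->
       exists2 w : H, ideal_set K w & val w = op (val u) (val v)) ->
    forall x y, L x -> L y -> L (op x y).
  move=> opP x y [F finF FP] [G finG GP]; exists (F `|` G); first by rewrite finite_setU.
  move=> H K; rewrite subUset => -[FH GH] YK.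
  by have [u Ku <-] := FP H K FH YK; have [v Kv <-] := GP H K GH YK; apply: opP.
(* The acting element must lie in [H] as well, so it joins the finite set. *)
have Lact (op : B -> B -> B) :
    (forall (H : subbrace B) (K : ideal H) (h : H) u, ideal_set K u ->
       exists2 w : H, ideal_set K w & val w = op (val h) (val u)) ->
    forall b x, L x -> L (op b x).
  move=> opP b x [F finF FP]; exists (F `|` [set b]); first by rewrite finite_setU.
  move=> H K; rewrite subUset => -[FH /(_ b erefl) Hb] YK.
  by have [u Ku <-] := FP H K FH YK; apply: (opP H K (sub_elt Hb)).
split; first split=> //.
- apply: Lop2 => H K u v Ku Kv; exists (u + v) => //.
  exact: (subbraceD (ideal_subbrace (ideal_setP K))).
- apply: Lop1 => H K u Ku; exists (- u) => //.
  exact: (subbraceN (ideal_subbrace (ideal_setP K))).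
- by rewrite sb1E.
- apply: Lop2 => H K u v Ku Kv; exists (u * v) => //; exact: idealM.
- apply: Lop1 => H K u Ku; exists (u^-1) => //; exact: idealV.
- move=> x b; apply: (Lact (fun b x => - b + x + b)) => H K h u Ku.
  by exists (- h + u + h) => //; apply: (ideal_normalD (ideal_setP K)).
- move=> x b; apply: (Lact (fun b x => b^-1 * x * b)) => H K h u Ku.
  by exists (h^-1 * u * h) => //; apply: (ideal_normalM (ideal_setP K)).
- apply: (Lact (@lambda B)) => H K h u Ku.
  by exists (lambda h u) => //; apply: (ideal_lambda (ideal_setP K)).
Qed.

Lemma restrict_is_ideal (B : skewBraceType) (H : subbrace B) (M : ideal B) :
  is_ideal [set u : H | ideal_set M (val u)].
Proof.
have [[s0 sD sN s1 sM sV] nD nM l] := ideal_setP M.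
split; first split=> //=.
- by move=> x y; apply: sD.
- by move=> x; apply: sN.
- by move=> x y; apply: sM.
- by move=> x; apply: sV.
- by move=> x a; apply: nD.
- by move=> x a; apply: nM.
- by move=> a x; apply: l.
Qed.

Lemma finitely_generated_subbrace (B : skewBraceType) (X : set B) : finite_set X ->
  exists2 H : subbrace B, finitely_generated H & X `<=` subbrace_set H.
Proof.
move=> finX; exists (Subbrace (smallest_subbrace X)) => /=; last exact: sub_gen_smallest.
by exists X.
Qed.

(* If a commutator [x = comm k a b] were outside [M], then [a] would lie in the ideal generated
   by [M] and [x]; in a suitable finitely generated subbrace [H] the elements [a] and [x] then
   enter the upper central series of [H] modulo [M] simultaneously, although [x] must come first. *)
Lemma chief_factor_central (B : skewBraceType) (M N : ideal B) :
  locally_centrally_nilpotent B -> ideal_set M `<=` ideal_set N ->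
  (forall S, is_ideal S -> ideal_set M `<=` S -> S `<=` ideal_set N ->
     S `<=` ideal_set M \/ ideal_set N `<=` S) ->
  ideal_set N `<=` centre_mod M.
Proof.
move=> lcn MN chief a Na; apply/centre_modP => k b; apply: contrapT => nMx.
set x := comm k a b in nMx; pose S := smallest (@is_ideal B) (ideal_set M `|` [set x]).
have Sa : S a.
  have [||SM|] := chief S (smallest_ideal _); last exact.
  - by apply: sub_smallest; apply: subsetUl.
  - apply: smallest_sub; first exact: ideal_setP.
    by rewrite subUset; split=> // y ->; apply: ideal_comm.
  - by case: nMx; apply: SM; apply: sub_gen_smallest; right.
have [F finF FP] := smallest_ideal_local Sa.
have [|H fgH] := @finitely_generated_subbrace B (F `|` [set a; b]).
  by rewrite finite_setU; split=> //; apply: finite_set2.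
rewrite !subUset => -[FH [/(_ a erefl) Ha /(_ b erefl) Hb]].
have [c zT] := lcn H fgH.
pose MH := Ideal (restrict_is_ideal H M).
pose ua := sub_elt Ha; pose ub := sub_elt Hb.
(* Descent: if [a] is in stage [n.+1], then [x] is in stage [n], and so is [a], by the certificate
   [FP]. Stage [0] is [M]. *)
have step n : ideal_set (zeta_over MH n) ua -> ideal_set M a.
  elim: n => // n IH /centre_modP za; apply: IH.
  have [|u zu ua'] := FP H (zeta_over MH n) FH; last first.
    by have -> : ua = u by apply: val_inj.
  move=> u [Mu|ux]; first exact: sub_zeta_over.
  have -> : u = comm k ua ub by apply: val_inj; rewrite val_comm.
  exact: za.
apply: nMx; apply: ideal_comm; apply: (step c).
apply: (zeta_over_mono (I := Ideal (zero_is_ideal H))).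
  by move=> u /= ->; exact: (subbrace0 (ideal_subbrace (ideal_setP M))).
by rewrite zeta_overE zT.
Qed.

(** * From the chain condition on ideals to finite generation and nilpotency *)

Lemma i_noetherian_fg_nilpotent (B : skewBraceType) :
  locally_centrally_nilpotent B -> i_noetherian B ->
  finitely_generated [set: B] /\ centrally_nilpotent B.
Proof.
move=> lcn acc.
have [X|X [finX _ genX]] := acc_finite_generation [set: B] acc.
  exact: smallest_ideal.
have [H fgH XH] := finitely_generated_subbrace finX.
have [c zT] := lcn H fgH.
have H1 : supplements H (gamma B 1).
  (* Everything is central modulo [gamma B 1], so this product is an ideal, and it contains the
     ideal generators [X]. *)
  have Si : is_ideal (supplement_set H (gamma B 1)).
    apply: central_mulgrp_ideal (supplement_set_mulgrp _ _) (@sub_supplement_set _ _ _) _.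
    by move=> x _; apply: gamma_centre_mod.
  by move=> b; apply: (genX _ Si) => // x /XH Hx; exists (sub_elt Hx).
(* The bound [c] for [H] also bounds the class of [B / I]. *)
have zB I : supplements H I -> ideal_set (zeta_over I c) = [set: B].
  move=> HI; apply/seteqP; split=> // b _; have [h e] := HI b.
  have : ideal_set (zeta_over I c) (val h) by apply: zeta_supplement => //; rewrite zT.
  by apply: (mulgrp_congr _ _ e); [exact: ideal_mulgrp|exact: sub_zeta_over].
have Gc n : ideal_set (gamma B c) `<=` ideal_set (gamma B n.+1).
  by apply: gamma_sub_zeta_over; apply: zB; apply: supplements_gamma.
(* The index is [c.+1] because [supplements_gamma] yields only positive indices. *)
have G0 : ideal_set (gamma B c.+1) `<=` [set 0].
  apply: contrapT => nG0.
  pose Q S := S `<=` ideal_set (gamma B c.+1) /\ ~ ideal_set (gamma B c.+1) `<=` S.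
  have [|M [Mi [MG nGM] maxM]] := acc_maximal (Q := Q) acc.
    exists [set 0]; first exact: zero_is_ideal.
    by split=> // x ->; rewrite -sb1E; apply: ideal1.
  (* [gamma B c.+1] lies in [gamma B c], hence in [gamma B c.+2], which centrality of the factor
     over [M] puts inside [M]. *)
  apply: nGM => x /gammaS_sub/(Gc c.+1); move: x.
  have GC : ideal_set (gamma B c.+1) `<=` centre_mod (Ideal Mi).
    apply: chief_factor_central => // S Si MS SG.
    have [|nGS] := pselect (ideal_set (gamma B c.+1) `<=` S); first by right.
    by left; apply: maxM.
  by apply: gamma_min => // k a b /GC/centre_modP; apply.
have H0 : supplements H (Ideal (zero_is_ideal B)).
  move=> b; have [h /quot_piP/G0 e] := supplements_gamma c H1 b.
  by exists h; apply/quot_piP.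
split; last by exists c; rewrite -zeta_overE zB.
have [Y finY eY] := fgH; exists Y => //; rewrite -eY; apply/seteqP; split=> // b _.
have [h /quot_piP/sbopp_uniq] := H0 b; rewrite sboppK => ->; exact: sub_eltP.
Qed.

Theorem corollary3p7 (B : skewBraceType) (hB : locally_centrally_nilpotent B) :
  (i_noetherian B <->
     finitely_generated [set: B]%classic /\ centrally_nilpotent B) /\
  (finitely_generated [set: B]%classic /\ centrally_nilpotent B <->
     s_noetherian B).
Proof.
have s_i : s_noetherian B -> i_noetherian B.
  by move=> acc C Ci; apply: acc => n; apply: ideal_subbrace.
have fg_s : finitely_generated [set: B]%classic /\ centrally_nilpotent B -> s_noetherian B.
  by case; apply: fg_nilpotent_s_noetherian.
have i_fg := i_noetherian_fg_nilpotent hB.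
by split; split=> //; [move=> /fg_s/s_i|move=> /s_i/i_fg].
Qed.
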